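(* Let $d\le n$ and $k\le n$ be positive integers, $\bm a_1,\dots,\bm a_n\in\mathbb{R}^d$, $\lambda>0$, and let $\bm A\in\mathbb{R}^{d\times n}$ be the matrix with columns $\bm a_1,\dots,\bm a_n$. Let $$z_k:=\min_{S\subseteq [n]}\left\{\operatorname{tr}\left(\left(\sum_{i\in S}\bm a_i\bm a_i^{\top}+\lambda \bm I_d\right)^{-1}\right): |S|=k\right\},$$ $$\nu_k^{\mathrm C}:=\min_{\bm x\in[0,1]^n}\left\{\operatorname{tr}\left(\left(\sum_{i\in[n]}x_i\bm a_i\bm a_i^{\top}+\lambda \bm I_d\right)^{-1}\right): \sum_{i\in[n]}x_i=k\right\}.$$ Then the first problem is equivalent to a mixed-integer second-order cone program: $$z_k=\min_{\bm x\in\{0,1\}^n,\ \bm X\in\mathbb{R}^{d\times n},\ \bm\mu\in\mathbb{R}_+^n}\left\{\frac1\lambda\|\bm X\bm A^{\top}-\bm I_d\|_F^2+\sum_{i\in[n]}\mu_i:\ \|\bm X_i\|_2^2\le\mu_ix_i\ \ \forall i\in[n],\ \sum_{i\in[n]}x_i=k\right\}.$$ In addition, the continuous relaxation of this program has value $\nu_k^{\mathrm C}$, that is, $$\nu_k^{\mathrm C}=\min_{\bm x\in[0,1]^n,\ \bm X\in\mathbb{R}^{d\times n},\ \bm\mu\in\mathbb{R}_+^n}\left\{\frac1\lambda\|\bm X\bm A^{\top}-\bm I_d\|_F^2+\sum_{i\in[n]}\mu_i:\ \|\bm X_i\|_2^2\le\mu_ix_i\ \ \forall i\in[n],\ \s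um_{i\in[n]}x_i=k\right\}.$$
   Context: $[n]=\{1,\dots,n\}$; $\bm X_i\in\mathbb{R}^d$ is the $i$-th column of $\bm X$; $\|\cdot\|_F$ is the Frobenius norm and $\|\cdot\|_2$ the Euclidean norm; $\mathbb{R}_+^n$ is the set of nonnegative vectors; $\bm I_d$ is the $d\times d$ identity matrix. *)

(* Defs.v *)
From HB Require Import structures.
From mathcomp Require Import all_boot all_order all_algebra.
From mathcomp Require Import classical_sets reals set_interval.

Set Implicit Arguments.
Unset Strict Implicit.
Unset Printing Implicit Defensive.

Import Order.TTheory GRing.Theory Num.Theory.
Local Open Scope classical_set_scope.
Local Open Scope ring_scope.

(* [m] is the minimum of [E]: attained, unlike a mere infimum. *)
Definition is_min (R : realType) (E : set R) (m : R) : Prop :=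
  E m /\ lbound E m.

(* The norm that MathComp-Analysis puts on matrices is the sup norm, hence the
   explicit definitions. *)
Definition frob_norm (R : realType) (m n : nat) (M : 'M[R]_(m, n)) : R :=
  Num.sqrt (\sum_(i < m) \sum_(j < n) M i j ^+ 2).

Definition eucl_norm (R : realType) (d : nat) (v : 'cV[R]_d) : R :=
  Num.sqrt (\sum_(i < d) v i 0 ^+ 2).

Definition colmx (R : realType) (d n : nat) (a : 'I_n -> 'cV[R]_d)
  : 'M[R]_(d, n) := \matrix_(l < d, i < n) a i l 0.

(* In the two trace objectives below [invmx] is a genuine inverse: its argument
   is positive definite when [lambda > 0] (and [x >= 0]). *)
Definition design_values (R : realType) (d n k : nat)
    (a : 'I_n -> 'cV[R]_d) (lambda : R) : set R :=
  [set v | exists2 S : {set 'I_n}, #|S| = k &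
     v = \tr (invmx (\sum_(i in S) a i *m (a i)^T + lambda%:M))].

Definition design_relax_values (R : realType) (d n k : nat)
    (a : 'I_n -> 'cV[R]_d) (lambda : R) : set R :=
  [set v | exists2 x : 'cV[R]_n,
     (forall i, 0 <= x i 0 <= 1) /\ \sum_(i < n) x i 0 = k%:R &
     v = \tr (invmx (\sum_(i < n) x i 0 *: (a i *m (a i)^T) + lambda%:M))].

(* The parameter [D] is the domain of each coordinate of [x]: [{0, 1}] gives the
   mixed-integer program, [[0, 1]] its continuous relaxation. *)
Definition socp_feasible (R : realType) (d n k : nat) (D : set R)
    (x : 'cV[R]_n) (X : 'M[R]_(d, n)) (mu : 'cV[R]_n) : Prop :=
  [/\ forall i, D (x i 0),
      forall i, 0 <= mu i 0,
      forall i, eucl_norm (col i X) ^+ 2 <= mu i 0 * x i 0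
    & \sum_(i < n) x i 0 = k%:R].

Definition socp_objective (R : realType) (d n : nat)
    (a : 'I_n -> 'cV[R]_d) (lambda : R)
    (X : 'M[R]_(d, n)) (mu : 'cV[R]_n) : R :=
  1 / lambda * frob_norm (X *m (colmx a)^T - 1%:M) ^+ 2 + \sum_(i < n) mu i 0.

Definition socp_values (R : realType) (d n k : nat) (D : set R)
    (a : 'I_n -> 'cV[R]_d) (lambda : R) : set R :=
  [set v | exists x : 'cV[R]_n, exists X : 'M[R]_(d, n), exists mu : 'cV[R]_n,
     socp_feasible k D x X mu /\ v = socp_objective a lambda X mu].

(* Main.v *)
(* Fix weights x >= 0 and write M = A diag(x) A^T + lambda I, N = M^-1. Both
   terms of the conic objective are bounded below by their tangents at the point
   X = N A diag(x), mu_i = x_i |N a_i|^2, and these tangents add up to the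
   constant tr N; at that point X A^T - I = - lambda N and the objective equals
   tr N. Hence for each x the optimal value over (X, mu) is tr N, whatever the
   domain of x. The minima are attained because the domain of x is finite,
   respectively compact with x |-> tr N continuous on it. *)
Require Import Defs.
From HB Require Import structures.
From mathcomp Require Import all_boot all_order all_algebra.
From mathcomp Require Import ring lra.
From mathcomp Require Import boolp classical_sets reals set_interval.
From mathcomp Require Import topology normedtype derive.

Set Implicit Arguments.
Unset Strict Implicit.

Import Order.TTheory GRing.Theory Num.Theory.
Import numFieldNormedType.Exports.
Local Open Scope classical_set_scope.
Local Open Scope ring_scope.

(** * Squared norms and traces as sums over entries *)

Lemma frob_norm_sqr (R : realType) (m n : nat) (P : 'M[R]_(m, n)) :
  frob_norm P ^+ 2 = \tr (P *m P^T).
Proof.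
rewrite /frob_norm sqr_sqrtr; last first.
  by apply: sumr_ge0 => i _; apply: sumr_ge0 => j _; apply: sqr_ge0.
rewrite /mxtrace; apply: eq_bigr => i _; rewrite mxE.
by apply: eq_bigr => j _; rewrite !mxE expr2.
Qed.

Lemma eucl_norm_sqr (R : realType) (d : nat) (v : 'cV[R]_d) :
  eucl_norm v ^+ 2 = \sum_(l < d) v l 0 ^+ 2.
Proof. by rewrite /eucl_norm sqr_sqrtr// sumr_ge0// => l _; apply: sqr_ge0. Qed.

Lemma mxtrace_mul_diag (R : comPzRingType) (m n : nat) (X Y : 'M[R]_(m, n))
    (w : 'rV[R]_n) :
  \tr (X *m diag_mx w *m Y^T) =
  \sum_(i < n) w 0 i * \sum_(l < m) X l i * Y l i.
Proof.
rewrite /mxtrace; under eq_bigr do rewrite mxE.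
rewrite exchange_big; apply: eq_bigr => i _ /=; rewrite mulr_sumr.
by apply: eq_bigr => l _; rewrite mul_mx_diag !mxE mulrAC mulrC mulrA.
Qed.

Lemma mxtrace_mul_tr (R : comPzRingType) (m n : nat) (X Y : 'M[R]_(m, n)) :
  \tr (X *m Y^T) = \sum_(i < n) \sum_(l < m) X l i * Y l i.
Proof.
rewrite /mxtrace; under eq_bigr do rewrite mxE.
by rewrite exchange_big; apply: eq_bigr => i _; apply: eq_bigr => l _; rewrite mxE.
Qed.

(** * Tangent lower bounds for the two terms of the objective *)

(** The gap is [1 / c] times the squared Frobenius norm of [P + c N]: this is the tangent at
    [P = - c N]. *)
Lemma mxtrace_sqr_ge (R : realFieldType) (m n : nat) (c : R)
    (P N : 'M[R]_(m, n)) : 0 < c ->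
  - 2 * \tr (P *m N^T) - c * \tr (N *m N^T) <= 1 / c * \tr (P *m P^T).
Proof.
move=> c0; rewrite !mxtrace_mul_tr !mulr_sumr -sumrB; apply: ler_sum => i _.
rewrite !mulr_sumr -sumrB; apply: ler_sum => l _.
rewrite -subr_ge0.
have -> : 1 / c * (P l i * P l i) -
    (-2 * (P l i * N l i) - c * (N l i * N l i)) =
    c^-1 * (P l i + c * N l i) ^+ 2 by field; rewrite gt_eqF.
by rewrite mulr_ge0 ?sqr_ge0// invr_ge0 ltW.
Qed.

(* For [w > 0] the left-hand side is the tangent of [|u|^2 / w] at [u = w y]. *)
Lemma rotated_cone_ge (R : realFieldType) (d : nat) (u y : 'I_d -> R) (mu w : R) :
  0 <= mu -> 0 <= w -> \sum_l u l ^+ 2 <= mu * w ->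
  2 * (\sum_l u l * y l) - w * (\sum_l y l * y l) <= mu.
Proof.
move=> mu0; rewrite le_eqVlt => /predU1P[<-|w0] h.
  (* For [w = 0] the cone constraint forces [u = 0], and the claim becomes [0 <= mu]. *)
  have {h} u0 l : u l = 0.
    apply/eqP; rewrite -sqrf_eq0.
    have /psumr_eq0P/(_ l isT)-> // : \sum_l u l ^+ 2 = 0.
      apply/eqP; rewrite mulr0 in h; rewrite eq_le h sumr_ge0// => ? _.
      exact: sqr_ge0.
    by move=> ? _; apply: sqr_ge0.
  rewrite big1 ?mulr0 ?mul0r ?subr0// => l _; by rewrite u0 mul0r.
rewrite -(ler_pM2r w0); apply: le_trans h.
rewrite mulrBl !mulr_sumr !mulr_suml -sumrB; apply: ler_sum => l _.
rewrite -subr_ge0.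
have -> : u l ^+ 2 - (2 * (u l * y l) * w - w * (y l * y l) * w) =
   (u l - w * y l) ^+ 2 by ring.
exact: sqr_ge0.
Qed.

(** * The regularized information matrix and its inverse *)

Definition info_mx (R : realType) (d n : nat) (a : 'I_n -> 'cV[R]_d)
    (lambda : R) (x : 'cV[R]_n) : 'M[R]_d :=
  \sum_(i < n) x i 0 *: (a i *m (a i)^T) + lambda%:M.

Lemma info_mxE (R : realType) (d n : nat) (a : 'I_n -> 'cV[R]_d)
    (lambda : R) (x : 'cV[R]_n) :
  info_mx a lambda x = colmx a *m diag_mx x^T *m (colmx a)^T + lambda%:M.
Proof.
congr (_ + _); apply/matrixP => r s; rewrite summxE mxE.
apply: eq_bigr => i _.
by rewrite mul_mx_diag !mxE big_ord1 !mxE mulrA (mulrC (x i 0)).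
Qed.

Lemma tr_info_mx (R : realType) (d n : nat) (a : 'I_n -> 'cV[R]_d)
    (lambda : R) (x : 'cV[R]_n) :
  (info_mx a lambda x)^T = info_mx a lambda x.
Proof.
by rewrite info_mxE linearD /= !trmx_mul trmxK tr_diag_mx tr_scalar_mx mulmxA.
Qed.

(** If [v M = 0], then [v M v^T] is a sum of nonnegative terms [x_i (v a_i)^2] and of
    [lambda |v|^2], all of which vanish; so [v = 0]. *)
Lemma info_mx_unit (R : realType) (d n : nat) (a : 'I_n -> 'cV[R]_d)
    (lambda : R) (x : 'cV[R]_n) :
  0 < lambda -> (forall i, 0 <= x i 0) -> info_mx a lambda x \in unitmx.
Proof.
move=> lambda_gt0 x_ge0.
rewrite -row_free_unit; apply/inj_row_free => v vM.
have : \tr (v *m info_mx a lambda x *m v^T) = 0 by rewrite vM mul0mx mxtrace0.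
rewrite info_mxE mulmxDr mulmxDl !mulmxA -mulmxA -trmx_mul mxtraceD.
rewrite mxtrace_mul_diag mul_mx_scalar -scalemxAl mxtraceZ mxtrace_mul_tr.
under [X in _ + _ * X]eq_bigr do rewrite big_ord1 -expr2.
move/eqP; rewrite paddr_eq0; first last.
- rewrite mulr_ge0 ?(ltW lambda_gt0)// sumr_ge0// => i _; exact: sqr_ge0.
- apply: sumr_ge0 => i _; rewrite mulr_ge0 ?mxE// sumr_ge0// => l _.
  by rewrite -expr2 sqr_ge0.
rewrite mulf_eq0 (gt_eqF lambda_gt0) /= => /andP[_ /eqP].
move=> /psumr_eq0P v0; apply/rowP => i; rewrite mxE.
by apply/eqP; rewrite -sqrf_eq0 v0// => j _; apply: sqr_ge0.
Qed.

Lemma tr_invmx_info (R : realType) (d n : nat) (a : 'I_n -> 'cV[R]_d)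
    (lambda : R) (x : 'cV[R]_n) :
  (invmx (info_mx a lambda x))^T = invmx (info_mx a lambda x).
Proof. by rewrite trmx_inv tr_info_mx. Qed.

(** Expand [M] in [N = N M N], with [N] symmetric. This evaluates the quadratic terms of the
    tangents as well as the objective at the optimum. *)
Lemma mxtrace_invmx_info (R : realType) (d n : nat) (a : 'I_n -> 'cV[R]_d)
    (lambda : R) (x : 'cV[R]_n) (N := invmx (info_mx a lambda x)) :
  info_mx a lambda x \in unitmx ->
  \tr N = \tr (N *m colmx a *m diag_mx x^T *m (N *m colmx a)^T) +
          lambda * \tr (N *m N^T).
Proof.
move=> Mu; rewrite -mxtraceZ -mxtraceD trmx_mul tr_invmx_info -/N; congr (\tr _).
rewrite -[LHS](mulmxK Mu) -/N [in LHS]info_mxE.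
by rewrite mulmxDr mulmxDl mul_mx_scalar -scalemxAl !mulmxA.
Qed.

(** * The optimal conic value for fixed weights *)

Lemma socp_objective_ge (R : realType) (d n k : nat) (D : set R)
    (a : 'I_n -> 'cV[R]_d) (lambda : R) (x : 'cV[R]_n) (X : 'M[R]_(d, n))
    (mu : 'cV[R]_n) :
  0 < lambda -> (forall i, 0 <= x i 0) -> socp_feasible k D x X mu ->
  \tr (invmx (info_mx a lambda x)) <= socp_objective a lambda X mu.
Proof.
move=> l0 x0 [_ mu0 cone _]; rewrite /socp_objective frob_norm_sqr.
set N := invmx _; set P := _ - _.
have Mu := info_mx_unit a l0 x0.
have := mxtrace_sqr_ge P N l0 => hp.
(* Sum of the cone bounds over the columns, with [y] the vector [N a_i]. *)
have hmu : 2 * \tr (X *m (N *m colmx a)^T) -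
    \tr (N *m colmx a *m diag_mx x^T *m (N *m colmx a)^T) <= \sum_i mu i 0.
  rewrite mxtrace_mul_tr mxtrace_mul_diag mulr_sumr -sumrB.
  apply: ler_sum => i _; rewrite mxE; apply: rotated_cone_ge => //.
  apply: le_trans (cone i); rewrite eucl_norm_sqr.
  by rewrite le_eqVlt; apply/orP/or_introl/eqP/eq_bigr => l _; rewrite mxE.
have hPN : \tr (P *m N^T) = \tr (X *m (N *m colmx a)^T) - \tr N.
  by rewrite mulmxBl mul1mx trmx_mul tr_invmx_info mulmxA raddfB.
have := mxtrace_invmx_info Mu; rewrite -/N => hN.
(* Adding [hp] and [hmu], the terms in [X] cancel; [2 \tr N] remains, and by [hN] the quadratic
   terms remove one [\tr N]. *)
by rewrite hPN in hp; lra.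
Qed.

Lemma socp_objective_attained (R : realType) (d n k : nat) (D : set R)
    (a : 'I_n -> 'cV[R]_d) (lambda : R) (x : 'cV[R]_n) :
  0 < lambda -> (forall i, 0 <= x i 0) -> (forall i, D (x i 0)) ->
  \sum_(i < n) x i 0 = k%:R ->
  socp_values k D a lambda (\tr (invmx (info_mx a lambda x))).
Proof.
move=> l0 x0 Dx sx; set N := invmx _; pose Y := N *m colmx a.
have Mu := info_mx_unit a l0 x0.
exists x, (Y *m diag_mx x^T), (\col_i (x i 0 * \sum_l Y l i * Y l i)).
split.
  split=> // i; rewrite ?mxE.
    by rewrite mulr_ge0// sumr_ge0// => l _; rewrite -expr2 sqr_ge0.
  (* The cone constraint is tight: both sides are [x_i^2 |N a_i|^2]. *)
  rewrite eucl_norm_sqr mulrAC mulr_sumr le_eqVlt; apply/orP/or_introl/eqP.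
  by apply: eq_bigr => l _; rewrite mul_mx_diag !mxE; ring.
rewrite /socp_objective frob_norm_sqr.
(* This is [N M = I] with [M] expanded. *)
have -> : Y *m diag_mx x^T *m (colmx a)^T - 1%:M = - (lambda *: N).
  have := mulVmx Mu; rewrite -/N {1}info_mxE mulmxDr mul_mx_scalar !mulmxA => <-.
  by rewrite opprD addrA subrr add0r.
rewrite mxtrace_invmx_info// -/N -/Y mxtrace_mul_diag addrC; congr (_ + _).
  rewrite -scaleNr [(_ *: N)^T]linearZ -scalemxAl -scalemxAr !mxtraceZ.
  by field; rewrite gt_eqF.
by apply: eq_bigr => i _; rewrite !mxE.
Qed.

(** * Transfer of minima from trace values to conic values *)

Lemma is_min_cofinal (R : realType) (E F : set R) (m : R) :
  E `<=` F -> (forall v, F v -> exists2 u, E u & u <= v) ->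
  is_min E m -> is_min F m.
Proof.
move=> EF FE [Em mE]; split; first exact: EF.
by move=> v /FE[u Eu]; apply: le_trans; apply: mE.
Qed.

(** Serves both programs. [E] is tied to the weights by an equation so that the problem over subsets
    fits too. *)
Lemma socp_values_min (R : realType) (d n k : nat) (D : set R)
    (a : 'I_n -> 'cV[R]_d) (lambda m : R) (E : set R) :
  0 < lambda -> D `<=` [set t | 0 <= t] ->
  E = [set v | exists2 x : 'cV[R]_n,
        (forall i, D (x i 0)) /\ \sum_(i < n) x i 0 = k%:R &
        v = \tr (invmx (info_mx a lambda x))] ->
  is_min E m -> is_min (socp_values k D a lambda) m.
Proof.
move=> l0 D0 ->; apply: is_min_cofinal.
  move=> _ [x [Dx sx] ->]; apply: socp_objective_attained => // i.
  by apply: D0; apply: Dx.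
move=> _ [x [X [mu [xXmu ->]]]]; have [Dx _ _ sx] := xXmu.
exists (\tr (invmx (info_mx a lambda x))); first by exists x.
by apply: socp_objective_ge xXmu => // i; apply: D0; apply: Dx.
Qed.

(** * The combinatorial problem: subsets as 0/1 vectors *)

Lemma design_valuesE (R : realType) (d n k : nat)
    (a : 'I_n -> 'cV[R]_d) (lambda : R) :
  design_values k a lambda =
  [set v | exists2 x : 'cV[R]_n,
     (forall i, [set 0; 1] (x i 0)) /\ \sum_(i < n) x i 0 = k%:R &
     v = \tr (invmx (info_mx a lambda x))].
Proof.
have infoE (S : {set 'I_n}) (x : 'cV[R]_n) :
    (forall i, x i 0 = (i \in S)%:R) ->
    info_mx a lambda x = \sum_(i in S) a i *m (a i)^T + lambda%:M /\
    \sum_(i < n) x i 0 = #|S|%:R.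
  move=> xS; split.
    congr (_ + _); rewrite [RHS]big_mkcond; apply: eq_bigr => i _.
    by rewrite xS; case: (i \in S); rewrite ?scale1r ?scale0r.
  under eq_bigr do rewrite xS.
  by rewrite -natr_sum -sum1_card [in RHS]big_mkcond.
rewrite eqEsubset; split=> v.
  case=> S <- ->; have xS i : (\col_i (i \in S)%:R : 'cV[R]_n) i 0 = (i \in S)%:R.
    by rewrite mxE.
  have [<- sx] := infoE S _ xS.
  exists (\col_i (i \in S)%:R) => //; split=> // i; rewrite xS.
  by case: (i \in S); [right|left].
case=> x [x01 sx] ->; pose S := [set i | x i 0 == 1]%SET.
have xS i : x i 0 = (i \in S)%:R.
  by rewrite inE; case: (x01 i) => ->; rewrite ?eqxx// eq_sym oner_eq0.
have [-> sS] := infoE S x xS; exists S => //.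
by apply/eqP; rewrite -(eqr_nat R) -sS sx.
Qed.

Lemma design_values_has_min (R : realType) (d n k : nat)
    (a : 'I_n -> 'cV[R]_d) (lambda : R) :
  (k <= n)%N -> exists z, is_min (design_values k a lambda) z.
Proof.
move=> kn.
have [S0 S0k] : exists S : {set 'I_n}, #|S| == k.
  (* The first [k] indices form a feasible set, so a minimum over the finitely many subsets
     exists. *)
  exists [set widen_ord kn i | i in 'I_k]%SET.
  by rewrite card_imset ?card_ord// => i j /(congr1 val) ij; apply: val_inj.
pose f (S : {set 'I_n}) := \tr (invmx (\sum_(i in S) a i *m (a i)^T + lambda%:M)).
have [S /eqP Sk Smin] := @arg_minP _ _ _ S0 (fun S => #|S| == k) f S0k.
exists (f S); split; first by exists S.
by move=> _ [T Tk ->]; apply: Smin; rewrite Tk.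
Qed.

(** * Attainment in the relaxed problem, by compactness *)

Lemma det_continuous (R : realType) (T : topologicalType) (m : nat)
    (F : T -> 'M[R]_m) :
  (forall i j, continuous (fun t => F t i j)) -> continuous (fun t => \det (F t)).
Proof.
move=> cF; apply: continuous_big => [|s _]; first exact: add_continuous.
move=> t; apply: (@continuousM R T); first exact: cst_continuous.
move: t; apply: continuous_big => [|i _]; first exact: mul_continuous.
exact: cF.
Qed.

Lemma adj_continuous (R : realType) (T : topologicalType) (m : nat)
    (F : T -> 'M[R]_m) (i j : 'I_m) :
  (forall i j, continuous (fun t => F t i j)) ->
  continuous (fun t => (\adj (F t)) i j).
Proof.
move=> cF; under eq_fun do rewrite mxE /cofactor.
move=> t; apply: (@continuousM R T); first exact: cst_continuous.
apply: det_continuous => r s; under eq_fun do rewrite !mxE.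
exact: cF.
Qed.

Lemma mxtrace_invmx_has_min (R : realType) (T : topologicalType) (m : nat)
    (F : T -> 'M[R]_m) (K : set T) :
  (forall i j, continuous (fun t => F t i j)) ->
  (forall t, K t -> F t \in unitmx) -> compact K -> K !=set0 ->
  exists z, is_min [set v | exists2 t, K t & v = \tr (invmx (F t))] z.
Proof.
move=> cF uF Kc K0.
(* [invmx] is defined by cases; Cramer's formula agrees with it on [K] and is continuous wherever
   the determinant is nonzero. *)
pose f t := (\det (F t))^-1 * \tr (\adj (F t)).
have fE t : K t -> \tr (invmx (F t)) = f t.
  by move=> /uF Fu; rewrite /invmx Fu mxtraceZ.
have cf : {in K, continuous f}.
  move=> t /set_mem/uF Ft; apply: (@continuousM R T).
    apply: continuousV; last exact: det_continuous.
    by rewrite -unitfE -unitmxE.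
  apply: continuous_big => [|i _]; first exact: add_continuous.
  exact: adj_continuous.
have [c /set_mem Kc' cmin] := compact_EVT_min K0 Kc (continuous_in_subspaceT cf).
exists (\tr (invmx (F c))); split; first by exists c.
by move=> _ [t Kt ->]; rewrite !fE//; apply: cmin; apply: mem_set.
Qed.

Lemma design_relax_values_has_min (R : realType) (d n k : nat)
    (a : 'I_n -> 'cV[R]_d) (lambda : R) :
  (0 < k)%N -> (k <= n)%N -> 0 < lambda ->
  exists nu, is_min (design_relax_values k a lambda) nu.
Proof.
move=> k0 kn l0.
have n0 : 0 < n%:R :> R by rewrite ltr0n (leq_trans k0).
(* Row vectors, to match [rV_compact]: [K] is a closed slice of the unit cube. *)
pose K : set 'rV[R]_n := [set u : 'rV[R]_n | forall i, `[0, 1]%classic (u ord0 i)] `&`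
  (fun u : 'rV[R]_n => \sum_i u 0 i) @^-1` [set k%:R].
have -> : design_relax_values k a lambda =
    [set v | exists2 u, K u & v = \tr (invmx (info_mx a lambda u^T))].
  rewrite eqEsubset; split=> v.
    case=> x [x01 sx] ->; exists x^T; rewrite ?trmxK//; split=> /=.
      by move=> i; rewrite in_itv /= mxE.
    by under eq_bigr do rewrite mxE.
  case=> u [u01 su] ->; exists u^T => //; split=> [i|].
    by have := u01 i; rewrite /= in_itv /= mxE.
  by under eq_bigr do rewrite mxE.
apply: mxtrace_invmx_has_min.
- move=> i j.
  (* Each entry is an affine function of the weights. *)
  have -> : (fun u : 'rV[R]_n => info_mx a lambda u^T i j) =
      (fun u => \sum_r u 0 r * (a r *m (a r)^T) i j + lambda%:M i j).
    apply/funext => u; rewrite mxE summxE; congr (_ + _).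
    by apply: eq_bigr => r _; rewrite !mxE.
  move=> u; apply: (@continuousD R R); last exact: cst_continuous.
  apply: continuous_big => [|r _]; first exact: add_continuous.
  move=> {}u; apply: (@continuousM R); last exact: cst_continuous.
  exact: coord_continuous.
- move=> u [u01 _]; apply: info_mx_unit => // i.
  by have := u01 i; rewrite /= in_itv /= mxE => /andP[].
- apply: compact_closedI.
    exact: (@rV_compact R n (fun=> `[0, 1]%classic)
      (fun=> @segment_compact R 0 1)).
  apply: preimage_closed; last exact: closed_eq.
  move=> u _; apply: continuous_big => [|r _]; first exact: add_continuous.
  exact: coord_continuous.
(* Equal weights [k / n] are feasible because [k <= n]. *)
- exists (const_mx (k%:R / n%:R)); split=> /= [i|].
    rewrite in_itv /= mxE divr_ge0 ?ler0n//=.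
    by rewrite ler_pdivrMr// mul1r ler_nat.
  under eq_bigr do rewrite mxE.
  by rewrite sumr_const card_ord -[LHS]mulr_natr divfK// gt_eqF.
Qed.

Theorem proposition2 (R : realType) (d n k : nat)
    (hd : (0 < d)%N) (hdn : (d <= n)%N) (hk : (0 < k)%N) (hkn : (k <= n)%N)
    (a : 'I_n -> 'cV[R]_d) (lambda : R) (hlambda : 0 < lambda) :
  (exists2 z : R,
     is_min (design_values k a lambda) z &
     is_min (socp_values k [set 0; 1] a lambda) z) /\
  (exists2 nu : R,
     is_min (design_relax_values k a lambda) nu &
     is_min (socp_values k `[0, 1] a lambda) nu).
Proof.
split.
  have [z zmin] := design_values_has_min a lambda hkn.
  exists z => //; apply: socp_values_min zmin => //; last exact: design_valuesE.
  by move=> _ /= [->|->].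
have [nu numin] := design_relax_values_has_min a hk hkn hlambda.
(* The equation for [E] holds by computation: membership in the interval unfolds to the two
   inequalities. *)
exists nu => //; apply: socp_values_min numin => //.
by move=> t /=; rewrite in_itv /= => /andP[].
Qed.
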